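(* Let $A,B\in M_{d}^{+}$ and $0\le v\le 1$. If $N$ is a nonnegative integer, then $$H_{v}(A,B)\ \leq\ A\nabla B-\sum_{n=0}^{N-1}r_{n}(v)\sum_{k=1}^{2^{n}}\left(H_{\frac{k-1}{2^{n}}}(A,B)+H_{\frac{k}{2^{n}}}(A,B)-2H_{\frac{2k-1}{2^{n+1}}}(A,B)\right)\chi_{\left(\frac{k-1}{2^{n}},\frac{k}{2^{n}}\right)}(v).$$
   Context: $M_d^+$ is the set of $d\times d$ complex positive definite matrices. For Hermitian matrices, $A\le B$ means $B-A$ is positive semidefinite. For $A,B\in M_d^+$ and $0\le v\le 1$: $A\nabla B=\frac12(A+B)$, $A\sharp_vB=A^{1/2}(A^{-1/2}BA^{-1/2})^vA^{1/2}$, and $H_v(A,B)=\frac12\left(A\sharp_vB+A\sharp_{1-v}B\right)$. The functions $r_n:[0,1]\to\mathbb{R}$ are defined recursively by $r_0(v)=\min\{v,1-v\}$ and $r_n(v)=\min\{2r_{n-1}(v),1-2r_{n-1}(v)\}$ for $n\ge 1$. $\chi_I$ is the characteristic function of the interval $I$. A sum $\sum_{n=0}^{N-1}$ is zero when $N=0$. *)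

(* Defs.v *)
From mathcomp Require Import all_boot all_order all_algebra.
From mathcomp Require Import mathcomp_extra boolp classical_sets set_interval.
From mathcomp Require Import reals numfun exp.
From mathcomp Require Import complex.

Set Implicit Arguments.
Unset Strict Implicit.
Unset Printing Implicit Defensive.

Import Order.TTheory GRing.Theory Num.Theory.
Local Open Scope ring_scope.
Local Open Scope complex_scope.
Local Open Scope sesquilinear_scope.

(* In the partial order of R[i], 0 <= z means that z is real and
   nonnegative, so the two quadratic-form conditions below are about real
   numbers. *)
Definition psdmx (R : realType) (d : nat) (A : 'M[R[i]]_d) : Prop :=
  A \is hermsymmx /\ forall x : 'cV[R[i]]_d, 0 <= (x ^t* *m A *m x) 0 0.

Definition pdmx (R : realType) (d : nat) (A : 'M[R[i]]_d) : Prop :=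
  A \is hermsymmx /\
  forall x : 'cV[R[i]]_d, x != 0 -> 0 < (x ^t* *m A *m x) 0 0.

Definition loewner_le (R : realType) (d : nat) (A B : 'M[R[i]]_d) : Prop :=
  psdmx (B - A).

(* Functional calculus A ^ p = U^* diag(l_i ^ p) U for A = U^* diag(l_i) U with
   U unitary, meant for positive definite A: the l_i are then positive reals,
   so p may be any real, in particular negative, and the value does not depend
   on the choice of U.  On other matrices the result is a junk value. *)
Definition mxpowR (R : realType) (d : nat) (A : 'M[R[i]]_d) (p : R) :
    'M[R[i]]_d :=
  invmx (spectralmx A)
  *m diag_mx (map_mx (fun z : R[i] => (complex.Re z `^ p)%:C) (spectral_diag A))
  *m spectralmx A.

Definition arith_mean (R : realType) (d : nat) (A B : 'M[R[i]]_d) :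
    'M[R[i]]_d :=
  2^-1 *: (A + B).

Definition geo_mean (R : realType) (d : nat) (v : R) (A B : 'M[R[i]]_d) :
    'M[R[i]]_d :=
  mxpowR A 2^-1
  *m mxpowR (mxpowR A (- 2^-1) *m B *m mxpowR A (- 2^-1)) v
  *m mxpowR A 2^-1.

Definition heinz_mean (R : realType) (d : nat) (v : R) (A B : 'M[R[i]]_d) :
    'M[R[i]]_d :=
  2^-1 *: (geo_mean v A B + geo_mean (1 - v) A B).

(* Defined on all of R; only its values on [0, 1] matter. *)
Fixpoint rseq (R : realType) (n : nat) (v : R) : R :=
  if n is m.+1 then Num.min (2 * rseq m v) (1 - 2 * rseq m v)
  else Num.min v (1 - v).

(* Main.v *)
Require Import Defs.
From HB Require Import structures.
From mathcomp Require Import all_boot all_order all_algebra.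
From mathcomp Require Import mathcomp_extra boolp classical_sets set_interval.
From mathcomp Require Import reals numfun exp.
From mathcomp Require Import complex.
From mathcomp Require Import interval_inference convex sequences.
From mathcomp Require Import ring lra.

Set Implicit Arguments.
Unset Strict Implicit.

Import Order.TTheory GRing.Theory Num.Theory.
Local Open Scope ring_scope.
Local Open Scope complex_scope.
Local Open Scope sesquilinear_scope.

(** Put C = A^(-1/2) B A^(-1/2), a positive definite matrix with unitary
    diagonalization C = U^* diag(l_1, ..., l_d) U.  Every matrix in the
    statement has the form A^(1/2) U^* diag(w) U A^(1/2) for a real row w, and
    this expression is linear in w: w = 1 gives A, w = l gives B, and the
    entries w_i = heinz l_i p give H_p(A, B) ([mean_calc], [heinz_meanE],
    [arith_meanE]).  Such a matrix is positive semidefinite as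
    soon as w >= 0 ([congr_calc_psd]).  So the matrix inequality follows from the scalar
    inequality for each eigenvalue l_i.

    For fixed l > 0 the scalar function p |-> (l^p + l^(1-p))/2 is convex, and
    it equals (1 + l)/2 both at 0 and at 1.  The scalar inequality holds for any
    function g convex on [0, 1]: the chord value (1 - v) g(0) + v g(1), once the
    first N correction terms are subtracted, is exactly the value at v of the
    piecewise linear interpolation of g at the points k / 2^N
    ([refinement_interpolates]), and a convex function lies below its
    chords.  The identity is an induction on N.  If v is at relative position t
    in a dyadic cell of length 2^-n, then r_n(v) = min(t, 1 - t), and moving the
    chord of the cell to the chord of the half that contains v lowers the value
    at v by min(t, 1 - t) times the second difference of g over the cell, which
    is the n-th correction term. *)

(** * Dyadic refinement of the chord inequality *)

(** The second difference of [g] over the [k]-th cell of level [n]; the cells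
    are numbered from 1. *)
Definition dyadic_gap (R : realType) (g : R -> R) (n k : nat) : R :=
  g ((k%:R - 1) / 2 ^+ n) + g (k%:R / 2 ^+ n)
  - 2 * g ((2 * k%:R - 1) / 2 ^+ n.+1).

Definition refinement (R : realType) (g : R -> R) (v : R) (N : nat) : R :=
  \sum_(0 <= n < N) rseq n v *
    \sum_(1 <= k < (2 ^ n).+1)
      (\1_(`](k%:R - 1) / 2 ^+ n, k%:R / 2 ^+ n[%classic) v : R) *
      dyadic_gap g n k.

Lemma pow2_gt0 (R : realType) n : 0 < 2 ^+ n :> R.
Proof. by rewrite exprn_gt0. Qed.

(** Only the cell whose interior contains the point contributes.  The cells are
    open, so no term is left when the point is an end of its cell, but then the
    factor [Num.min t (1 - t)] vanishes: the identity holds for closed cells. *)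
Lemma dyadic_cell_sum (R : realType) (G : nat -> R) (n j : nat) (t : R) :
    (j < 2 ^ n)%N -> 0 <= t <= 1 ->
  Num.min t (1 - t) *
    \sum_(1 <= k < (2 ^ n).+1)
      (\1_(`](k%:R - 1) / 2 ^+ n, k%:R / 2 ^+ n[%classic)
         ((j%:R + t) / 2 ^+ n) : R) * G k
  = Num.min t (1 - t) * G j.+1.
Proof.
move=> jn /andP[t0 t1].
have [->|tn0] := eqVneq t 0; first by rewrite subr0 minElt ltr01 !mul0r.
have [->|tn1] := eqVneq t 1; first by rewrite subrr minElt ltr10 !mul0r.
have t0' : 0 < t by rewrite lt_neqAle eq_sym tn0.
have t1' : t < 1 by rewrite lt_neqAle tn1.
congr (_ * _).
rewrite (bigD1_seq j.+1) ?iota_uniq ?mem_index_iota ?ltnS//=.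
rewrite big1 ?addr0 => [|k kj]; rewrite indicE mem_setE in_itv /=
  ltr_pM2r ?invr_gt0 ?pow2_gt0 // ltr_pM2r ?invr_gt0 ?pow2_gt0 //.
  have -> : (j.+1%:R - 1 < j%:R + t) && (j%:R + t < j.+1%:R) :> bool.
    by rewrite -natr1; apply/andP; split; lra.
  by rewrite mul1r.
have [/andP[a b]|] := boolP (_ && _); last by rewrite mul0r.
suff: k = j.+1 by move/eqP; rewrite (negbTE kj).
apply/eqP; rewrite eqn_leq -ltnS -[(j < k)%N]ltnS -!(ltr_nat R) -!natr1.
by apply/andP; split; lra.
Qed.

(** Each correction term replaces the chord over a cell by the chord over the
    half of the cell that contains [v].  The position [t] of [v] inside its cell
    evolves by the doubling map, in step with the recursion for [rseq]; it is
    part of the conclusion because the induction needs it. *)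
Lemma refinement_interpolates (R : realType) (g : R -> R) (v : R) (N : nat) :
    0 <= v <= 1 ->
  exists j t, [/\ (j < 2 ^ N)%N, 0 <= t <= 1, v = (j%:R + t) / 2 ^+ N,
    rseq N v = Num.min t (1 - t) &
    (1 - v) * g 0 + v * g 1 - refinement g v N =
    (1 - t) * g (j%:R / 2 ^+ N) + t * g (j.+1%:R / 2 ^+ N)].
Proof.
move=> v01; rewrite /refinement; elim: N => [|N [j [t [jN t01 vE rE IH]]]].
  exists 0%N, v; split => //; first by rewrite expr0 divr1 add0r.
  by rewrite big_nil subr0 expr0 !divr1.
have [th|th] := leP t 2^-1.
(* v lies in the left half, whose right end is the midpoint of the cell. *)
- exists j.*2, (2 * t); split.
  + by rewrite expnS mul2n ltn_double.
  + lra.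
  + rewrite vE -mul2n natrM exprS; field.
    exact/lt0r_neq0/pow2_gt0.
  + rewrite [LHS]/= rE; congr (Num.min _ _); rewrite minEle ifT; lra.
  + rewrite big_nat_recr //= opprD addrA IH [in X in _ - X]rE.
    rewrite {1}[in X in _ - X]vE
      dyadic_cell_sum // /dyadic_gap minEle ifT; last lra.
    have -> : j.*2%:R / 2 ^+ N.+1 = j%:R / 2 ^+ N :> R.
      rewrite -mul2n natrM exprS; field; exact/lt0r_neq0/pow2_gt0.
    have -> : 2 * j.+1%:R - 1 = j.*2.+1%:R :> R.
      by rewrite -[j.+1%:R]natr1 -[j.*2.+1%:R]natr1 -mul2n natrM; ring.
    have -> : j.+1%:R - 1 = j%:R :> R by rewrite -natr1; ring.
    ring.
(* v lies in the right half, whose left end is the midpoint of the cell. *)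
- exists j.*2.+1, (2 * t - 1); split.
  + by rewrite expnS mul2n ltn_Sdouble.
  + lra.
  + rewrite vE -[j.*2.+1%:R]natr1 -mul2n natrM exprS; field.
    exact/lt0r_neq0/pow2_gt0.
  + rewrite [LHS]/= rE minC; congr (Num.min _ _); rewrite minElt; case: ifP => *; lra.
  + rewrite big_nat_recr //= opprD addrA IH [in X in _ - X]rE.
    rewrite {1}[in X in _ - X]vE
      dyadic_cell_sum // /dyadic_gap minElt ifF; last lra.
    have -> : j.*2.+2%:R / 2 ^+ N.+1 = j.+1%:R / 2 ^+ N :> R.
      rewrite -doubleS -mul2n natrM exprS; field; exact/lt0r_neq0/pow2_gt0.
    have -> : 2 * j.+1%:R - 1 = j.*2.+1%:R :> R.
      by rewrite -[j.+1%:R]natr1 -[j.*2.+1%:R]natr1 -mul2n natrM; ring.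
    have -> : j.+1%:R - 1 = j%:R :> R by rewrite -natr1; ring.
    ring.
Qed.

(** Over the cell that contains [v], the interpolation is a chord of [g]. *)
Lemma convex_le_refinement (R : realType) (g : R -> R) (v : R) (N : nat) :
    (forall a b t : R, 0 <= a <= 1 -> 0 <= b <= 1 -> 0 <= t <= 1 ->
       g ((1 - t) * a + t * b) <= (1 - t) * g a + t * g b) ->
    0 <= v <= 1 ->
  g v <= (1 - v) * g 0 + v * g 1 - refinement g v N.
Proof.
move=> gconv v01.
have [j [t [jN t01 vE _ ->]]] := refinement_interpolates g N v01.
have unit_cell (i : nat) : (i <= 2 ^ N)%N -> 0 <= (i%:R / 2 ^+ N : R) <= 1.
  move=> iN; rewrite divr_ge0 ?ler0n ?exprn_ge0 //=.
  by rewrite ler_pdivrMr ?pow2_gt0 // mul1r -natrX ler_nat.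
rewrite [in g v](_ : v = (1 - t) * (j%:R / 2 ^+ N) + t * (j.+1%:R / 2 ^+ N)).
  by apply: gconv t01; apply: unit_cell => //; exact: ltnW.
rewrite vE -natr1; field; exact/lt0r_neq0/pow2_gt0.
Qed.

(** * Convexity of scalar Heinz means *)

Lemma expR_convex (R : realType) (x y t : R) : 0 <= t <= 1 ->
  expR ((1 - t) * x + t * y) <= (1 - t) * expR x + t * expR y.
Proof.
move=> /andP[t0 t1].
have s0 : 0 <= 1 - t by rewrite subr_ge0.
have s1 : 1 - t <= 1 by rewrite gerBl.
have := @convex_expR R (Itv01 s0 s1) x y.
rewrite !convRE /= /unstable.onem.
by have -> : 1 - (1 - t) = t by ring.
Qed.

Lemma powR_convex_exponent (R : realType) (l a b t : R) : 0 < l -> 0 <= t <= 1 ->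
  l `^ ((1 - t) * a + t * b) <= (1 - t) * l `^ a + t * l `^ b.
Proof.
move=> l0 t01; rewrite /powR (gt_eqF l0).
have -> : ((1 - t) * a + t * b) * ln l = (1 - t) * (a * ln l) + t * (b * ln l).
  by ring.
exact: expR_convex.
Qed.

Definition heinz (R : realType) (l p : R) : R := 2^-1 * (l `^ p + l `^ (1 - p)).

Lemma heinz_convex (R : realType) (l a b t : R) : 0 < l -> 0 <= t <= 1 ->
  heinz l ((1 - t) * a + t * b) <= (1 - t) * heinz l a + t * heinz l b.
Proof.
move=> l0 t01; rewrite /heinz.
have -> : 1 - ((1 - t) * a + t * b) = (1 - t) * (1 - a) + t * (1 - b) by ring.
have := powR_convex_exponent a b l0 t01.
have := powR_convex_exponent (1 - a) (1 - b) l0 t01.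
lra.
Qed.

Lemma heinz0 (R : realType) (l : R) : 0 < l -> heinz l 0 = 2^-1 * (1 + l).
Proof. by move=> l0; rewrite /heinz powRr0 subr0 powRr1 // ltW. Qed.

Lemma heinz1 (R : realType) (l : R) : 0 < l -> heinz l 1 = 2^-1 * (1 + l).
Proof. by move=> l0; rewrite /heinz subrr powRr0 powRr1 ?(ltW l0) // addrC. Qed.

(** * Functional calculus in a unitary eigenbasis *)

Section SpectralCalculus.
Variables (C : numClosedFieldType) (d : nat).
Implicit Types (A S : 'M[C]_d) (w u : 'rV[C]_d).

(** A row [w] of eigenvalues, instead of a function applied to the spectrum, so
    that linearity in [w] is plain linear algebra. *)
Definition spectral_calc A w : 'M[C]_d :=
  invmx (spectralmx A) *m diag_mx w *m spectralmx A.

Lemma spectral_calc_diag A :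
  A \is hermsymmx -> spectral_calc A (spectral_diag A) = A.
Proof. by move=> Ah; rewrite [RHS](orthomx_spectralP (hermitian_normalmx Ah)). Qed.

Lemma spectral_calcM A u w :
  spectral_calc A u *m spectral_calc A w = spectral_calc A (\row_i (u 0 i * w 0 i)).
Proof.
rewrite /spectral_calc !mulmxA mulmxK ?spectral_unit // -!mulmxA.
by congr (_ *m _); rewrite !mulmxA mulmx_diag.
Qed.

Lemma spectral_calc1 A : spectral_calc A (const_mx 1) = 1%:M.
Proof. by rewrite /spectral_calc diag_const_mx mulmx1 mulVmx ?spectral_unit. Qed.

Lemma unitmx_right_inverse (S T : 'M[C]_d) : S *m T = 1%:M -> S \in unitmx.
Proof. by case/mulmx1_unit. Qed.

Lemma congr_inverseK (A S T : 'M[C]_d) : S *m T = 1%:M -> T *m S = 1%:M ->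
  S *m (T *m A *m T) *m S = A.
Proof. by move=> ST TS; rewrite !mulmxA ST mul1mx -mulmxA TS mulmx1. Qed.

Lemma hermsymmxP A : A \is hermsymmx <-> A ^t* = A.
Proof.
split=> [/is_hermitianmxP|AE]; first by rewrite expr0 scale1r.
by apply/is_hermitianmxP; rewrite expr0 scale1r.
Qed.

Lemma adjmxM m n p (X : 'M[C]_(m, n)) (Y : 'M[C]_(n, p)) :
  (X *m Y) ^t* = Y ^t* *m X ^t*.
Proof. by rewrite trmx_mul map_mxM. Qed.

Lemma hermsymmx_congr A S : A \is hermsymmx -> S ^t* *m A *m S \is hermsymmx.
Proof.
move=> /hermsymmxP Ah.
by apply/hermsymmxP; rewrite !adjmxM trmxCK Ah mulmxA.
Qed.

Lemma spectral_calc_adj A w : (forall i, w 0 i \is Num.real) ->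
  (spectral_calc A w) ^t* = spectral_calc A w.
Proof.
move=> wreal.
rewrite /spectral_calc invmx_unitary ?spectral_unitarymx // !adjmxM trmxCK mulmxA.
congr (_ *m _ *m _); rewrite tr_diag_mx map_diag_mx; congr diag_mx.
by apply/rowP => i; rewrite !mxE; exact: conj_Creal.
Qed.

(** In the coordinates [y = U x], with [U] the eigenbasis of [A], the quadratic form is the sum of the
    [w_i * |y_i|^2]. *)
Lemma spectral_calc_form_ge0 A w (x : 'cV[C]_d) : (forall i, 0 <= w 0 i) ->
  0 <= (x ^t* *m spectral_calc A w *m x) 0 0.
Proof.
move=> w0; rewrite /spectral_calc invmx_unitary ?spectral_unitarymx //.
set U := spectralmx A; rewrite !mulmxA -adjmxM -!mulmxA; set y := U *m x.
rewrite mulmxA mul_mx_diag !mxE; apply: sumr_ge0 => i _; rewrite !mxE.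
by rewrite mulrAC mulr_ge0 // mulrC -normCK exprn_ge0.
Qed.

(** The vector is the unit eigenvector [U^* e_i], with [U] the eigenbasis of [A];
    testing definiteness on it gives the sign of the eigenvalue. *)
Lemma spectral_diag_form A i : A \is hermsymmx ->
  exists2 x : 'cV[C]_d, x != 0 & (x ^t* *m A *m x) 0 0 = spectral_diag A 0 i.
Proof.
move=> Ah; set U := spectralmx A.
have Uu : U \is unitarymx := spectral_unitarymx A.
have [x Ux] : exists x : 'cV[C]_d, U *m x = delta_mx i 0.
  by exists (U ^t* *m delta_mx i 0); rewrite mulmxA (unitarymxP Uu) mul1mx.
exists x.
  apply/eqP => x0; move/matrixP/(_ i 0)/eqP: Ux.
  by rewrite x0 mulmx0 !mxE !eqxx eq_sym oner_eq0.
rewrite -{1}(spectral_calc_diag Ah) /spectral_calc -/U invmx_unitary //.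
rewrite !mulmxA -adjmxM -mulmxA Ux.
rewrite mul_mx_diag !mxE (bigD1 i) //= big1 => [|k ki]; rewrite !mxE.
  by rewrite !eqxx conjC1 mul1r mulr1 addr0.
by rewrite (negbTE ki) mulr0.
Qed.

Definition congr_calc S A w : 'M[C]_d := S *m spectral_calc A w *m S.

Lemma congr_calc_linear S A : linear (congr_calc S A).
Proof.
move=> a u w; rewrite /congr_calc /spectral_calc linearP /=.
by rewrite mulmxDr mulmxDl mulmxDr mulmxDl -!scalemxAr -!scalemxAl -!scalemxAr
  -!scalemxAl.
Qed.

HB.instance Definition _ S A := GRing.isLinear.Build C 'rV[C]_d 'M[C]_d _
  (congr_calc S A) (congr_calc_linear S A).

End SpectralCalculus.

(** * Real powers of positive definite matrices *)

Section PositiveDefinite.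
Variables (R : realType) (d : nat).
Implicit Types (A B S : 'M[R[i]]_d) (w : 'rV[R]_d).

Definition eigval A (i : 'I_d) : R := complex.Re (spectral_diag A 0 i).

Definition rowC w : 'rV[R[i]]_d := \row_i (w 0 i)%:C.

Lemma mxpowRE A p :
  mxpowR A p = spectral_calc A (rowC (\row_i (eigval A i `^ p))).
Proof.
have -> : rowC (\row_i (eigval A i `^ p)) =
    map_mx (fun z : R[i] => (complex.Re z `^ p)%:C) (spectral_diag A).
  by apply/rowP => i; rewrite !mxE.
by [].
Qed.

Lemma real_complex_real (a : R) : a%:C \is Num.real.
Proof. by apply/complex_realP; exists a. Qed.

Lemma mxpowR_adj A p : (mxpowR A p) ^t* = mxpowR A p.
Proof.
by rewrite mxpowRE; apply: spectral_calc_adj => i; rewrite mxE real_complex_real.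
Qed.

Lemma rowC_eigval A : A \is hermsymmx -> rowC (\row_i eigval A i) = spectral_diag A.
Proof.
move=> Ah; apply/rowP => i; rewrite !mxE; apply: RRe_real.
by have /mxOverP := hermitian_spectral_diag_real Ah; apply.
Qed.

Lemma eigval_gt0 A i : pdmx A -> 0 < eigval A i.
Proof.
move=> [Ah Apos]; have [x x0 xE] := spectral_diag_form i Ah.
by have := Apos x x0; rewrite xE -rowC_eigval // !mxE ltcR.
Qed.

Lemma pdmx_congr A S : S \in unitmx -> pdmx A -> pdmx (S ^t* *m A *m S).
Proof.
move=> Su [Ah Apos]; split; first exact: hermsymmx_congr.
move=> x x0; have := Apos (S *m x); rewrite adjmxM !mulmxA; apply.
by apply: contra_neq x0 => Sx0; rewrite -(mulKmx Su x) Sx0 mulmx0.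
Qed.

Lemma congr_calc_psd S A w : S ^t* = S -> (forall i, 0 <= w 0 i) ->
  psdmx (congr_calc S A (rowC w)).
Proof.
move=> Sh w0; rewrite /congr_calc -{1}Sh; split.
  apply/hermsymmx_congr/hermsymmxP/spectral_calc_adj => i.
  by rewrite mxE real_complex_real.
move=> x.
have := @spectral_calc_form_ge0 _ _ A (rowC w) (S *m x).
by rewrite adjmxM !mulmxA; apply => i; rewrite mxE lecR.
Qed.

Lemma mxpowRD A (p q : R) : pdmx A ->
  mxpowR A p *m mxpowR A q = mxpowR A (p + q).
Proof.
move=> Apd; rewrite !mxpowRE spectral_calcM; congr spectral_calc.
apply/rowP => i; have := eigval_gt0 i Apd; rewrite !mxE => l0.
by rewrite powRD ?rmorphM // (lt0r_neq0 l0) implybT.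
Qed.

Lemma mxpowR0 A : mxpowR A 0 = 1%:M.
Proof.
rewrite mxpowRE -(spectral_calc1 A); congr spectral_calc.
by apply/rowP => i; rewrite !mxE powRr0.
Qed.

Lemma mxpowR1 A : pdmx A -> mxpowR A 1 = A.
Proof.
move=> Apd; have [Ah _] := Apd.
rewrite mxpowRE.
have -> : \row_i (eigval A i `^ 1) = \row_i eigval A i.
  by apply/rowP => i; rewrite !mxE powRr1 //; exact/ltW/eigval_gt0.
rewrite (rowC_eigval Ah).
exact: spectral_calc_diag Ah.
Qed.

Lemma mxpowR_unit A p : pdmx A -> mxpowR A p \in unitmx.
Proof.
move=> Apd; apply: (@unitmx_right_inverse _ _ _ (mxpowR A (- p))).
apply: etrans (mxpowRD _ _ Apd) _.
by rewrite subrr mxpowR0.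
Qed.

End PositiveDefinite.

(** * Means as functions of the relative eigenvalues *)

Section Means.
Variables (R : realType) (d : nat).
Implicit Types (A B : 'M[R[i]]_d) (w : 'rV[R]_d).

Definition relative A B := mxpowR A (- 2^-1) *m B *m mxpowR A (- 2^-1).

Lemma relative_pd A B : pdmx A -> pdmx B -> pdmx (relative A B).
Proof.
move=> Apd Bpd; rewrite /relative -{1}mxpowR_adj.
by apply: pdmx_congr => //; exact: mxpowR_unit.
Qed.

(** The congruence by [A^(1/2)] carries the commuting pair [(1, C)], with
    [C = relative A B], to the pair [(A, B)]; every mean of [A] and [B] is the
    image of a function of [C]. *)
Definition mean_calc A B (l : 'rV[R]_d) :=
  congr_calc (mxpowR A 2^-1) (relative A B) (rowC l).

Lemma mean_calcB A B : {morph mean_calc A B : u w / u - w}.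
Proof.
move=> u w; rewrite /mean_calc -raddfB; congr congr_calc.
by apply/rowP => i; rewrite !mxE rmorphB.
Qed.

HB.instance Definition _ A B := GRing.isZmodMorphism.Build 'rV[R]_d 'M[R[i]]_d
  (mean_calc A B) (mean_calcB A B).

Lemma mean_calcZ A B (a : R) w : mean_calc A B (a *: w) = a%:C *: mean_calc A B w.
Proof.
rewrite /mean_calc -linearZ; congr congr_calc.
by apply/rowP => i; rewrite !mxE rmorphM.
Qed.

Lemma geo_meanE A B p :
  geo_mean p A B = mean_calc A B (\row_i (eigval (relative A B) i `^ p)).
Proof. by rewrite /geo_mean -/(relative A B) [mxpowR (relative _ _) _]mxpowRE. Qed.

Lemma mean_calc_left A B : pdmx A -> mean_calc A B (const_mx 1) = A.
Proof.
move=> Apd; rewrite /mean_calc /congr_calc.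
have -> : rowC (const_mx 1) = const_mx 1 :> 'rV[R[i]]_d.
  by apply/rowP => i; rewrite !mxE.
rewrite spectral_calc1 mulmx1 mxpowRD //.
have -> : 2^-1 + 2^-1 = 1 :> R by lra.
exact: mxpowR1.
Qed.

Lemma mean_calc_right A B : pdmx A -> pdmx B ->
  mean_calc A B (\row_i eigval (relative A B) i) = B.
Proof.
move=> Apd Bpd; have [Ch _] := relative_pd Apd Bpd.
rewrite /mean_calc /congr_calc rowC_eigval // spectral_calc_diag //.
apply: congr_inverseK; apply: etrans (mxpowRD _ _ Apd) _.
  by rewrite subrr mxpowR0.
by rewrite addNr mxpowR0.
Qed.

Lemma halfC : 2^-1 = (2^-1 : R)%:C :> R[i].
Proof. by rewrite fmorphV rmorph_nat. Qed.

Definition heinz_row A B p : 'rV[R]_d :=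
  \row_i heinz (eigval (relative A B) i) p.

Lemma heinz_meanE A B p : heinz_mean p A B = mean_calc A B (heinz_row A B p).
Proof.
rewrite /heinz_mean !geo_meanE -raddfD halfC -mean_calcZ; congr mean_calc.
by apply/rowP => i; rewrite !mxE.
Qed.

Lemma arith_meanE A B : pdmx A -> pdmx B -> arith_mean A B =
  mean_calc A B (2^-1 *: (const_mx 1 + \row_i eigval (relative A B) i)).
Proof.
move=> Apd Bpd.
by rewrite mean_calcZ raddfD /= mean_calc_left // mean_calc_right // -halfC.
Qed.

End Means.

Theorem theorem14 (R : realType) (d : nat) (A B : 'M[R[i]]_d) (v : R) (N : nat)
    (hA : pdmx A) (hB : pdmx B) (hv : 0 <= v <= 1) :
  loewner_le (heinz_mean v A B)
    (arith_mean A B -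
     \sum_(0 <= n < N) (rseq n v)%:C *:
       \sum_(1 <= k < (2 ^ n).+1)
         (\1_(`](k%:R - 1) / 2 ^+ n, k%:R / 2 ^+ n[%classic) v : R)%:C *:
         (heinz_mean ((k%:R - 1) / 2 ^+ n) A B + heinz_mean (k%:R / 2 ^+ n) A B
          - 2 *: heinz_mean ((2 * k%:R - 1) / 2 ^+ n.+1) A B)).
Proof.
(* The row whose image under [mean_calc A B] is the whole correction sum. *)
pose w := \sum_(0 <= n < N) rseq n v *:
  \sum_(1 <= k < (2 ^ n).+1)
    (\1_(`](k%:R - 1) / 2 ^+ n, k%:R / 2 ^+ n[%classic) v : R) *:
    (heinz_row A B ((k%:R - 1) / 2 ^+ n) + heinz_row A B (k%:R / 2 ^+ n)
     - 2%:R *: heinz_row A B ((2 * k%:R - 1) / 2 ^+ n.+1)).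
set corr := \sum_(0 <= n < N) _.
have -> : corr = mean_calc A B w.
  rewrite raddf_sum; apply: eq_bigr => n _ /=.
  rewrite mean_calcZ; congr (_ *: _); rewrite raddf_sum.
  apply: eq_bigr => k _ /=; rewrite mean_calcZ; congr (_ *: _).
  by rewrite raddfB raddfD /= mean_calcZ rmorph_nat !heinz_meanE.
rewrite /loewner_le heinz_meanE arith_meanE // -!raddfB.
apply: congr_calc_psd => [|i]; first exact: mxpowR_adj.
set l := eigval (relative A B) i.
have l0 : 0 < l by exact/eigval_gt0/relative_pd.
have wE : w 0 i = refinement (heinz l) v N.
  rewrite summxE; apply: eq_bigr => n _; rewrite mxE summxE; congr (_ * _).
  by apply: eq_bigr => k _; rewrite !mxE.
have hconv (a b t : R) : 0 <= a <= 1 -> 0 <= b <= 1 -> 0 <= t <= 1 ->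
    heinz l ((1 - t) * a + t * b) <= (1 - t) * heinz l a + t * heinz l b.
  by move=> _ _; exact: heinz_convex.
have := convex_le_refinement N hconv hv.
rewrite -wE heinz0 // heinz1 // -subr_ge0.
congr (_ <= _); rewrite !mxE -/l; ring.
Qed.
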